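(* Let $X, Y$ be topological spaces and let $F : X \rightrightarrows Y$ be a multifunction such that $F(x)$ is non-empty and finite for all $x \in X$. If $F$ is upper semicontinuous at a point $p \in X$, then $F$ is pre-multi-split at $p$. If $F$ is globally upper semicontinuous, then $F$ is pre-multi-split.
   Context: A neighborhood of a point $p$ (respectively of a subset $S$) in a topological space is a set $V$, not necessarily open, for which there is an open set $U$ with $p \in U \subseteq V$ (respectively $S \subseteq U \subseteq V$). Let $f : X \to Y$ be a function between topological spaces and $p \in X$. The function $f$ is multi-split continuous at $p$ if there exists a finite non-empty set $Z_p \subseteq Y$ such that: (a) for every $y \in Z_p$ and all neighborhoods $U \subseteq X$ of $p$ and $V \subseteq Y$ of $y$ one has $f(U) \cap V \neq \varnothing$; (b) for every neighborhood $V \subseteq Y$ of the set $Z_p$ there exists a neighborhood $U \subseteq X$ of $p$ with $f(U) \subseteq V$. The function $f$ is globally multi-split continuous if it is multi-split continuous at every $p \in X$. A multifunction $F : X \rightrightarrows Y$ is a map assigning to each $x \in X$ a subset $F(x) \subseteq Y$. It is upper semicontinuous at $p \in X$ if for every neighborhood $V \subseteq Y$ of $F(p)$ the set $\{x \in X : F(x) \subseteq V\}$ is a neighborhood of $p$; it is globally upper semicontinuous if this holds at every $p \in X$. A selection of $F$ is a function $f : X \to Y$ with $f(x) \in F(x)$ for all $x \in X$. $F$ is pre-multi-split at $p$ if every selection of $F$ is multi-split continuous at $p$, and pre-multi-split if every selection of $F$ is globally multi-split continuous. *)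

(* Defs.v *)
From mathcomp Require Import all_boot all_order all_algebra.
From mathcomp Require Import all_classical.
From mathcomp Require Import topology.

Set Implicit Arguments.
Unset Strict Implicit.
Unset Printing Implicit Defensive.

Local Open Scope classical_set_scope.

(* Neighborhoods are not assumed open: [nbhs p] is unfolded by [nbhsE] and
   [set_nbhs S], for a set [S], by [set_nbhsP].
   A multifunction from [X] to [Y] is a map [X -> set Y]. *)

Definition multi_split_continuous_at (X Y : topologicalType) (f : X -> Y)
    (p : X) : Prop :=
  exists Z : set Y,
    [/\ finite_set Z, Z !=set0,
        (forall y, Z y -> forall (U : set X) (V : set Y),
           nbhs p U -> nbhs y V -> (f @` U) `&` V !=set0) &
        (forall V : set Y, set_nbhs Z V ->
           exists2 U : set X, nbhs p U & f @` U `<=` V)].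

Definition multi_split_continuous (X Y : topologicalType) (f : X -> Y) : Prop :=
  forall p : X, multi_split_continuous_at f p.

Definition usc_at (X Y : topologicalType) (F : X -> set Y) (p : X) : Prop :=
  forall V : set Y, set_nbhs (F p) V -> nbhs p [set x | F x `<=` V].

Definition usc (X Y : topologicalType) (F : X -> set Y) : Prop :=
  forall p : X, usc_at F p.

Definition selection (X Y : Type) (F : X -> set Y) (f : X -> Y) : Prop :=
  forall x : X, F x (f x).

Definition pre_multi_split_at (X Y : topologicalType) (F : X -> set Y)
    (p : X) : Prop :=
  forall f : X -> Y, selection F f -> multi_split_continuous_at f p.

Definition pre_multi_split (X Y : topologicalType) (F : X -> set Y) : Prop :=
  forall f : X -> Y, selection F f -> multi_split_continuous f.

(* Main.v *)
Require Import Defs.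
From mathcomp Require Import all_boot all_order all_algebra.
From mathcomp Require Import all_classical.
From mathcomp Require Import topology.

Local Open Scope classical_set_scope.

(** Let [f] be a selection of [F].  The set that witnesses multi-split
continuity of [f] at [p] is the part of [F p] that [f] really approaches: the
points of [F p] that are cluster points of the image filter [f @ p].  That
[f] comes near each of these points is the definition of a cluster point.  That
[f] stays, near [p], in any neighborhood of the witness comes from upper
semicontinuity, which gives this for neighborhoods of the whole of [F p].  Since
[F p] is finite, hence compact, the points of [F p] that are not cluster points
can be discarded ([compact_cluster_absorb]): each has a neighborhood that [f]
avoids near [p], and finitely many such neighborhoods cover what has to be
discarded.  The witness is not empty, since otherwise the
empty set would be a neighborhood of it and would have to contain [f p]. *)

(** Each point of [K] has a neighborhood [B] such that some member [A] of [G]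
meets [B] only inside [V]: for a cluster point, because [B] can be taken inside
[V]; for any other point, because [A] and [B] can be taken disjoint.
Compactness yields one [A] for all points of [K], so that [V `|` ~` A] is a
neighborhood of [K], and intersecting it with [A] leaves a subset of [V]. *)
Lemma compact_cluster_absorb (T : topologicalType) (G : set_system T)
    (FG : ProperFilter G) (K : set T) :
  compact K -> (forall W, set_nbhs K W -> G W) ->
  forall V, set_nbhs (K `&` cluster G) V -> G V.
Proof.
move=> /compact_near_coveringP Kcov GK V KV.
have downward A A' : A `<=` A' -> K `<=` (fun y => nbhs y (V `|` ~` A')) ->
    K `<=` (fun y => nbhs y (V `|` ~` A)).
  move=> AA' KA' y /KA'; apply: filterS.
  by apply: setUS; apply: subsetC.
(* [nbhs y] inside the property makes [V `|` ~` A] a neighborhood of [K], not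
   just a superset. *)
have : \forall A \near powerset_filter_from G,
    K `<=` (fun y => nbhs y (V `|` ~` A)).
  apply: Kcov => y Ky.
  have [Gy|/existsNP [A /existsNP [B /not_implyP [GA /not_implyP [yB AB]]]]] :=
    pselect (cluster G y).
  - have yV : \near y, nbhs y V by apply: near_join; exact: KV.
    near=> z A.
    have : nbhs z V by near: z.
    by apply: filterS => t; left.
  - have yB' : \near y, nbhs y B by exact: near_join.
    near=> z A'.
    have A'A : A' `<=` A by near: A'; exact: small_set_sub.
    have : nbhs z B by near: z.
    apply: filterS => t Bt; right => A't.
    by apply: AB; exists t; split=> //; exact: A'A.
move=> /near_powerset_filter_fromP -/(_ downward) [A GA KA].
by apply: filterS (filterI (GK _ KA) GA) => t [[]].
Unshelve. all: by end_near.
Qed.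

Lemma usc_pre_multi_split_at (X Y : topologicalType) (F : X -> set Y) (p : X) :
  finite_set (F p) -> usc_at F p -> pre_multi_split_at F p.
Proof.
move=> Fp uscF f Ff.
have absorb V : set_nbhs (F p `&` cluster (f @ p)) V -> nbhs p (f @^-1` V).
  apply: compact_cluster_absorb (finite_compact Fp) _ _ => W /uscF.
  by apply: filterS => x; apply; exact: Ff.
exists (F p `&` cluster (f @ p)); split.
- exact: sub_finite_set Fp.
- apply/set0P/eqP => Z0.
  have : set_nbhs (F p `&` cluster (f @ p)) set0 by rewrite Z0 => y [].
  by move=> /absorb/nbhs_singleton.
- move=> y [_ cly] U V pU; apply: cly.
  by apply: filterS pU => x Ux; exists x.
- by move=> V /absorb pV; exists (f @^-1` V) => //; exact: image_preimage_subset.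
Qed.

Theorem theorem5p3 (X Y : topologicalType) (F : X -> set Y)
    (F_nonempty : forall x : X, F x !=set0)
    (F_finite : forall x : X, finite_set (F x)) :
  (forall p : X, usc_at F p -> pre_multi_split_at F p) /\
  (usc F -> pre_multi_split F).
Proof.
split=> [p|uscF f Ff p]; first exact: usc_pre_multi_split_at.
exact: usc_pre_multi_split_at.
Qed.
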